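(* Let $(P_n)_{n\in\mathbb{Z}}$ be the Padovan sequence extended to all integers: $P_0=P_1=P_2=1$ and $P_n=P_{n-2}+P_{n-3}$ for all integers $n$. Then for every integer $n\ge 1$: (a) $\sum_{k=1}^{n}P_{-k}=-2P_{-n-1}-2P_{-n-2}-P_{-n-3}+2.$ (b) $\sum_{k=1}^{n}P_{-2k}=-P_{-2n+1}+1.$ (c) $\sum_{k=1}^{n}P_{-2k+1}=-P_{-2n}-P_{-2n-1}+1.$ *)

(* Defs.v *)
From HB Require Import structures.
From mathcomp Require Import all_boot all_order all_algebra.
From mathcomp Require Import zify ring.
Set Implicit Arguments.
Unset Strict Implicit.
Unset Printing Implicit Defensive.
Import Order.TTheory GRing.Theory Num.Theory.
Local Open Scope ring_scope.

Definition is_padovan (P : int -> int) : Prop :=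
  [/\ P 0 = 1, P 1 = 1, P 2 = 1
    & forall n : int, P n = P (n - 2) + P (n - 3)].

(* The window (P_n, P_(n+1), P_(n+2)) determines its two neighbours, since the
   recurrence can also be read downwards as P_(n-1) = P_(n+2) - P_n. *)
Definition padovan_next (w : int * int * int) : int * int * int :=
  let: (a, b, c) := w in (b, c, a + b).
Definition padovan_prev (w : int * int * int) : int * int * int :=
  let: (a, b, c) := w in (c - a, a, b).
Definition padovan_window (n : int) : int * int * int :=
  match n with
  | Posz m => iter m padovan_next (1, 1, 1)
  | Negz m => iter m.+1 padovan_prev (1, 1, 1)
  end.
Definition padovan (n : int) : int := (padovan_window n).1.1.

Lemma padovan_windowS (n : int) :
  padovan_window (n + 1) = padovan_next (padovan_window n).
Proof.
case: n => [m|[|m]].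
- by have -> : Posz m + 1 = Posz m.+1 by lia.
- by [].
have -> : Negz m.+1 + 1 = Negz m by lia.
rewrite /padovan_window [in RHS]iterS.
case: (iter _ _ _) => [[a b] c] /=; congr (_, _, _); ring.
Qed.

Lemma padovan_exists : is_padovan padovan.
Proof.
split=> // n.
have -> : n = n - 3 + 1 + 1 + 1 by ring.
set m := n - 3.
have -> : m + 1 + 1 + 1 - 2 = m + 1 by ring.
have -> : m + 1 + 1 + 1 - 3 = m by ring.
rewrite /padovan !padovan_windowS.
by case: (padovan_window m) => [[a b] c] /=; ring.
Qed.

Lemma padovan_unique (P : int -> int) : is_padovan P -> P =1 padovan.
Proof.
case=> P0 P1 P2 Prec.
have rec m : P (m + 3) = P m + P (m + 1).
  by rewrite Prec addrC; congr (P _ + P _); ring.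
suff win n : (P n, P (n + 1), P (n + 2)) = padovan_window n.
  by move=> n; rewrite /padovan -win.
elim/int_rect: n => [|m IH|m IH].
  by rewrite /= !add0r P0 P1 P2.
- have -> : Posz m.+1 = m%:Z + 1 by lia.
  rewrite padovan_windowS -IH /=.
  have -> : m%:Z + 1 + 1 = m%:Z + 2 by ring.
  have -> : m%:Z + 1 + 2 = m%:Z + 3 by ring.
  by rewrite rec.
have [k Ek] : exists k, k = - m.+1%:Z by eexists.
move: IH; rewrite -Ek; have -> : - m%:Z = k + 1 by lia.
rewrite padovan_windowS.
have -> : k + 1 + 1 = k + 2 by ring.
have -> : k + 1 + 2 = k + 3 by ring.
rewrite rec; case: (padovan_window k) => [[a b] c] /= [-> -> E].
by congr (_, _, _); apply: (addIr b).
Qed.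

(* Main.v *)
Require Import Defs.
From HB Require Import structures.
From mathcomp Require Import all_boot all_order all_algebra.
From mathcomp Require Import zify ring.
Set Implicit Arguments.
Unset Strict Implicit.
Unset Printing Implicit Defensive.
Import Order.TTheory GRing.Theory Num.Theory.
Local Open Scope ring_scope.

(* Each right-hand side vanishes at n = 0, and its increment from n to n + 1 is
   the new summand by the Padovan recurrence, so the sums telescope. *)

(** The closed forms are discrete antiderivatives: [sum_telescope] reduces each identity to a check
    at 0, which uses the values of [P] at 1, 0, -1, -2, -3, and one application of the recurrence
    per increment. *)

Lemma sum_telescope (V : zmodType) (f F : nat -> V) (n : nat) :
  F 0%N = 0 -> (forall m, F m.+1 = F m + f m.+1) ->
  \sum_(1 <= k < n.+1) f k = F n.
Proof.
move=> F0 FS; elim: n => [|n IH]; first by rewrite big_geq.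
by rewrite big_nat_recr //= IH FS.
Qed.

Theorem corollary3p10 (P : int -> int) (hP : is_padovan P)
    (n : nat) (hn : (1 <= n)%N) :
  [/\ \sum_(1 <= k < n.+1) P (- k%:Z)
        = - 2 * P (- n%:Z - 1) - 2 * P (- n%:Z - 2) - P (- n%:Z - 3) + 2,
      \sum_(1 <= k < n.+1) P (- 2 * k%:Z) = - P (- 2 * n%:Z + 1) + 1
    & \sum_(1 <= k < n.+1) P (- 2 * k%:Z + 1)
        = - P (- 2 * n%:Z) - P (- 2 * n%:Z - 1) + 1].
Proof.
have [P0 P1 P2 rec] := hP.
(* The recurrence at 2, 1, 0 is solved for its lowest term; the integer indices agree by
   computation. *)
have Pm1 : P (- 1) = 0 by have: P 2 = P 0 + P (- 1) := rec 2; lia.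
have Pm2 : P (- 2) = 1 by have: P 1 = P (- 1) + P (- 2) := rec 1; lia.
have Pm3 : P (- 3) = 0 by have: P 0 = P (- 2) + P (- 3) := rec 0; lia.
split.
- apply: (sum_telescope (f := fun k => P (- k%:Z))
    (F := fun n => - 2 * P (- n%:Z - 1) - 2 * P (- n%:Z - 2)
                   - P (- n%:Z - 3) + 2)) => [|m].
    by rewrite !add0r Pm1 Pm2 Pm3.
  have -> : - m.+1%:Z = - m%:Z - 1 by lia.
  (* The increment is [2 * P x - P (x - 2) - P (x - 3)], which is [P x]. *)
  set x := - m%:Z - 1.
  have -> : - m%:Z - 2 = x - 1 by rewrite /x; ring.
  have -> : - m%:Z - 3 = x - 2 by rewrite /x; ring.
  by rewrite (rec x); ring.
- apply: (sum_telescope (f := fun k => P (- 2 * k%:Z))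
    (F := fun n => - P (- 2 * n%:Z + 1) + 1)) => [|m].
    by rewrite mulr0 add0r P1.
  have -> : - 2 * m.+1%:Z = - 2 * m%:Z - 2 by lia.
  set y := - 2 * m%:Z.
  (* The increment [P (y + 1) - P (y - 1)] is [P (y - 2)] by the recurrence at [y + 1]. *)
  have -> : y - 2 + 1 = y + 1 - 2 by ring.
  rewrite (rec (y + 1)); have -> : y + 1 - 3 = y - 2 by ring.
  ring.
apply: (sum_telescope (f := fun k => P (- 2 * k%:Z + 1))
  (F := fun n => - P (- 2 * n%:Z) - P (- 2 * n%:Z - 1) + 1)) => [|m].
  by rewrite mulr0 add0r P0 Pm1.
have -> : - 2 * m.+1%:Z = - 2 * m%:Z - 2 by lia.
set y := - 2 * m%:Z.
(* Here [P (y - 2) + P (y - 3)] collapses to [P y], leaving the increment [P (y - 1)]. *)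
have -> : y - 2 + 1 = y - 1 by ring.
have -> : y - 2 - 1 = y - 3 by ring.
by rewrite (rec y); ring.
Qed.
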